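(* Let $E,F$ be connected directed graphs, $p:F\to E$ a covering map, $T$ a spanning tree for $E$ and $v\in E^0$. Let $w\in F^0$ be such that $p(w)=v$. Then there exists a map $c=c_{v,T}:E^1\to\pi_1(E,v)$ such that $$F\cong E\times_c\bigl(p_*\pi_1(F,w)\backslash\pi_1(E,v)\bigr)$$ as directed graphs.
   Context: A directed graph $E$ consists of sets $E^0$ (vertices), $E^1$ (edges) and maps $r,s:E^1\to E^0$. A graph morphism $\phi:F\to E$ consists of maps $\phi^i:F^i\to E^i$ ($i=0,1$) commuting with $r$ and $s$. A graph morphism $p:F\to E$ is a covering map if for each $u\in F^0$, $p$ maps $r^{-1}(u)$ bijectively onto $r^{-1}(p(u))$ and $s^{-1}(u)$ bijectively onto $s^{-1}(p(u))$. For $e\in E^1$ let $e^{-1}$ be the formal reverse edge, with $s(e^{-1})=r(e)$, $r(e^{-1})=s(e)$, $(e^{-1})^{-1}=e$; $E^{-1}$ is the set of reverse edges. A walk is a sequence $a=a_1\cdots a_n$ with $a_i\in E^1\cup E^{-1}$ and $r(a_i)=s(a_{i+1})$; $s(a)=s(a_1)$, $r(a)=r(a_n)$ (vertices are trivial walks). It is reduced if it contains no subword $bb^{-1}$, $b\in E^1\cup E^{-1}$. The set $\pi_1(E)$ of reduced walks is a groupoid with unit space $E^0$: the product $a\cdot b$, defined when $r(a)=s(b)$, is concatenation followed by cancellation, and $(a_1\cdots a_n)^{-1}=a_n^{-1}\cdots a_1^{-1}$. For $v\in E^0$, $\pi_1(E,v)=\{a\in\pi_1(E):s(a)=v=r(a)\}$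 is the isotropy group at $v$. A covering map $p:F\to E$ induces a morphism $p_*:\pi_1(F)\to\pi_1(E)$ by $p(a_1\cdots a_n)=p(a_1)\cdots p(a_n)$, $p(f^{-1})=p(f)^{-1}$. $E$ is connected if there is a reduced walk between any two distinct vertices. A tree is a directed graph with precisely one reduced walk between any two vertices. A spanning tree of $E$ is a subgraph $T$ which is a tree with $T^0=E^0$. Given a group $\Gamma$ with subgroup $H$ and a function $c:E^1\to\Gamma$, the relative skew product graph $E\times_c(H\backslash\Gamma)$ has vertex set $E^0\times(H\backslash\Gamma)$ and edge set $E^1\times(H\backslash\Gamma)$, where $H\backslash\Gamma=\{Hg:g\in\Gamma\}$, with $s(e,Hg)=(s(e),Hg)$ and $r(e,Hg)=(r(e),Hgc(e))$. *)

(* Defs.v *)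
From HB Require Import structures.
From mathcomp Require Import all_boot.
From mathcomp Require Import boolp classical_sets functions.

Set Implicit Arguments.
Unset Strict Implicit.
Unset Printing Implicit Defensive.

Local Open Scope classical_set_scope.

Record digraph : Type := Digraph {
  vert : Type;
  edge : Type;
  rng : edge -> vert;
  src : edge -> vert }.

Record graph_hom (F E : digraph) : Type := GraphHom {
  hom0 : vert F -> vert E;
  hom1 : edge F -> edge E;
  hom_rng : forall f, rng (hom1 f) = hom0 (rng f);
  hom_src : forall f, src (hom1 f) = hom0 (src f) }.

Definition graph_iso (F E : digraph) : Prop :=
  exists phi : graph_hom F E, bijective (hom0 phi) /\ bijective (hom1 phi).

Record covering (F E : digraph) : Type := Covering {
  cov_hom :> graph_hom F E;
  cov_rng : forall u : vert F,
    set_bij (@rng F @^-1` [set u]) (@rng E @^-1` [set hom0 cov_hom u])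
            (hom1 cov_hom);
  cov_src : forall u : vert F,
    set_bij (@src F @^-1` [set u]) (@src E @^-1` [set hom0 cov_hom u])
            (hom1 cov_hom) }.

Inductive letter (E : digraph) : Type := Fwd of edge E | Bwd of edge E.

Section Letters.
Variable E : digraph.
Implicit Types (x y : letter E) (a b : seq (letter E)) (u v : vert E).

Definition lsrc x := match x with Fwd e => src e | Bwd e => rng e end.
Definition lrng x := match x with Fwd e => rng e | Bwd e => src e end.
Definition linv x := match x with Fwd e => Bwd e | Bwd e => Fwd e end.

(* [walk_from u a]: the word [a] is a walk with source [u]; the base point is
   recorded so that the empty word yields one trivial walk for every vertex. *)
Fixpoint walk_from u a : Prop :=
  if a is x :: a' then lsrc x = u /\ walk_from (lrng x) a' else True.

Definition walk_end u a : vert E := last u (map lrng a).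

Definition reduced a : Prop := forall s x t, a <> s ++ x :: linv x :: t.

Definition cancel_cons x a : seq (letter E) :=
  if a is y :: a' then if `[< y = linv x >] then a' else x :: a else [:: x].

(* One pass from right to left reaches the reduced form: [reduce_reduced]. *)
Definition reduce a : seq (letter E) := foldr cancel_cons [::] a.

Definition winv a : seq (letter E) := rev (map linv a).

Lemma linvK : involutive linv. Proof. by case. Qed.

Lemma lsrc_inv x : lsrc (linv x) = lrng x. Proof. by case: x. Qed.

Lemma lrng_inv x : lrng (linv x) = lsrc x. Proof. by case: x. Qed.

Lemma walk_from_cat u a b :
  walk_from u (a ++ b) <-> walk_from u a /\ walk_from (walk_end u a) b.
Proof.
elim: a u => [|x a IH] u /=; first by split=> [|[]].
by rewrite IH; split=> [[-> []]|[[-> ?] ?]].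
Qed.

Lemma walk_end_cat u a b : walk_end u (a ++ b) = walk_end (walk_end u a) b.
Proof. by rewrite /walk_end map_cat last_cat. Qed.

Lemma reduced_nil : reduced [::].
Proof. by case. Qed.

Lemma reduced_behead x a : reduced (x :: a) -> reduced a.
Proof. by move=> ra s y t e; apply: (ra (x :: s) y t); rewrite e. Qed.

Lemma reduced_cons x y a :
  y <> linv x -> reduced (y :: a) -> reduced (x :: y :: a).
Proof. by move=> yx ra [|z s] t b [] // ? // e; [subst | exact: ra e]. Qed.

Lemma reduced_head x y a : reduced (x :: y :: a) -> y <> linv x.
Proof. by move=> ra yx; apply: (ra [::] x a); rewrite yx. Qed.

Lemma cancel_cons_walk u x a :
  walk_from u (x :: a) ->
  walk_from u (cancel_cons x a) /\ walk_end u (cancel_cons x a) = walk_end u (x :: a).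
Proof.
case: a => [|y a] //= [xu [yx wa]]; case: asboolP => [eyx|_] //=.
move: wa yx; rewrite eyx lrng_inv lsrc_inv xu => wa _.
by rewrite /walk_end /= lrng_inv xu.
Qed.

Lemma cancel_cons_reduced x a : reduced a -> reduced (cancel_cons x a).
Proof.
case: a => [|y a] ra /=; first by case=> [|? [|? ?]].
case: asboolP => yx; first exact: reduced_behead ra.
exact: reduced_cons.
Qed.

Lemma cancel_consK x a : reduced a -> cancel_cons x (cancel_cons (linv x) a) = a.
Proof.
case: a => [|y a] ra /=; first by case: asboolP.
case: asboolP => [yx|_] /=; last by case: asboolP.
rewrite linvK in yx; subst y; case: a ra => [|z a] // /reduced_head zx /=.
by case: asboolP.
Qed.

Lemma reduce_reduced a : reduced (reduce a).
Proof. by elim: a => [|x a IH]; [exact: reduced_nil | exact: cancel_cons_reduced]. Qed.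

Lemma reduce_id a : reduced a -> reduce a = a.
Proof.
elim: a => [|x a IH] ra //=; rewrite IH; last exact: reduced_behead ra.
by case: a ra {IH} => [|y a] //= /reduced_head yx; case: asboolP.
Qed.

Lemma reduce_walk u a :
  walk_from u a ->
  walk_from u (reduce a) /\ walk_end u (reduce a) = walk_end u a.
Proof.
elim: a u => [|x a IH] u //= [xu /IH [wa ea]].
have [|w' e'] := @cancel_cons_walk u x (reduce a); first by [].
by split=> //; rewrite e' /walk_end /= -/(walk_end _ _) ea.
Qed.

Lemma reduce_cat a b : reduce (a ++ b) = foldr cancel_cons (reduce b) a.
Proof. exact: foldr_cat. Qed.

Lemma foldr_cancel_cons x a c : reduced c ->
  foldr cancel_cons c (cancel_cons x a) = cancel_cons x (foldr cancel_cons c a).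
Proof.
move=> rc; case: a => [|y a] //=; case: asboolP => [->|//] /=.
rewrite cancel_consK //.
by elim: a {y} => //= y a; exact: cancel_cons_reduced.
Qed.

Lemma reduce_catl a b : reduce (reduce a ++ b) = reduce (a ++ b).
Proof.
elim: a => //= x a <-; rewrite !reduce_cat foldr_cancel_cons //.
exact: reduce_reduced.
Qed.

Lemma reduce_catr a b : reduce (a ++ reduce b) = reduce (a ++ b).
Proof. by rewrite !reduce_cat (reduce_id (@reduce_reduced b)). Qed.

Lemma winvK : involutive winv.
Proof. by move=> a; rewrite /winv map_rev revK mapK //; exact: linvK. Qed.

Lemma winv_cons x a : winv (x :: a) = winv a ++ [:: linv x].
Proof. by rewrite /winv /= rev_cons cats1. Qed.

Lemma winv_cat a b : winv (a ++ b) = winv b ++ winv a.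
Proof. by rewrite /winv map_cat rev_cat. Qed.

Lemma winv_walk u a :
  walk_from u a ->
  walk_from (walk_end u a) (winv a) /\ walk_end (walk_end u a) (winv a) = u.
Proof.
elim: a u => [|x a IH] u //= [xu /IH [wa ea]].
rewrite winv_cons walk_from_cat walk_end_cat -[walk_end u _]/(walk_end (lrng x) a).
by rewrite ea /walk_end /= lsrc_inv lrng_inv.
Qed.

Lemma winv_reduced a : reduced a -> reduced (winv a).
Proof.
move=> ra s x t e; apply: (ra (winv t) x (winv s)).
by rewrite -[a]winvK e winv_cat !winv_cons linvK -!catA.
Qed.

Lemma reduce_winvr a : reduce (a ++ winv a) = [::].
Proof.
elim: a => // x a IH; rewrite winv_cons /= catA -reduce_catl IH /=.
by case: asboolP.
Qed.

Lemma reduce_winvl a : reduce (winv a ++ a) = [::].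
Proof. by rewrite -{2}[a]winvK reduce_winvr. Qed.

End Letters.

Record rwalk (E : digraph) : Type := RWalk {
  wsrc : vert E;
  word : seq (letter E);
  word_walk : walk_from wsrc word;
  word_reduced : reduced word }.

Section Groupoid.
Variable E : digraph.
Implicit Types a b : rwalk E.

Definition wrng a : vert E := walk_end (wsrc a) (word a).

Lemma rwalk_eq a b : wsrc a = wsrc b -> word a = word b -> a = b.
Proof.
case: a b => [u a wa ra] [v b wb rb] /= uv ab; subst v b.
by congr RWalk; exact: Prop_irrelevance.
Qed.

Definition gunit (v : vert E) : rwalk E :=
  @RWalk E v [::] I (@reduced_nil E).

Lemma gmul_walk a b : wrng a = wsrc b -> walk_from (wsrc a) (reduce (word a ++ word b)).
Proof.
move=> ab; apply: (proj1 (@reduce_walk _ _ _ _)); apply/walk_from_cat.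
by split; [exact: word_walk | rewrite -/(wrng a) ab; exact: word_walk].
Qed.

Definition gmul a b (ab : wrng a = wsrc b) : rwalk E :=
  @RWalk E (wsrc a) (reduce (word a ++ word b)) (gmul_walk ab)
    (@reduce_reduced E _).

Lemma wrng_gmul a b (ab : wrng a = wsrc b) : wrng (gmul ab) = wrng b.
Proof.
rewrite /wrng /= (proj2 (@reduce_walk _ _ _ _)).
  by rewrite walk_end_cat -/(wrng a) ab.
apply/walk_from_cat.
by split; [exact: word_walk | rewrite -/(wrng a) ab; exact: word_walk].
Qed.

Definition ginv a : rwalk E :=
  @RWalk E (wrng a) (winv (word a)) (proj1 (winv_walk (word_walk a)))
    (winv_reduced (@word_reduced E a)).

Lemma wrng_ginv a : wrng (ginv a) = wsrc a.
Proof. exact: (proj2 (winv_walk (word_walk a))). Qed.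

End Groupoid.

Record pi1 (E : digraph) (v : vert E) : Type := Pi1 {
  pi1_walk :> rwalk E;
  pi1_src : wsrc pi1_walk = v;
  pi1_rng : wrng pi1_walk = v }.

Section FundamentalGroup.
Variables (E : digraph) (v : vert E).
Implicit Types a b : pi1 v.

Lemma pi1_eq a b : word a = word b -> a = b.
Proof.
case: a b => [a sa ta] [b sb tb] /= ab.
have e : a = b by apply: rwalk_eq; rewrite ?sa.
by subst b; congr Pi1; exact: Prop_irrelevance.
Qed.

Definition pi1_one : pi1 v := @Pi1 E v (gunit v) erefl erefl.

Definition pi1_mul a b : pi1 v :=
  let ab := etrans (pi1_rng a) (esym (pi1_src b)) in
  @Pi1 E v (gmul ab) (pi1_src a) (etrans (wrng_gmul ab) (pi1_rng b)).

Definition pi1_inv a : pi1 v :=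
  @Pi1 E v (ginv a) (pi1_rng a) (etrans (wrng_ginv a) (pi1_src a)).

Lemma pi1_mulA : associative pi1_mul.
Proof. by move=> a b c; apply: pi1_eq => /=; rewrite reduce_catr reduce_catl catA. Qed.

Lemma pi1_mul1 : left_id pi1_one pi1_mul.
Proof. by move=> a; apply: pi1_eq => /=; rewrite reduce_id //; exact: word_reduced. Qed.

Lemma pi1_mulr1 : right_id pi1_one pi1_mul.
Proof.
by move=> a; apply: pi1_eq => /=; rewrite cats0 reduce_id //; exact: word_reduced.
Qed.

Lemma pi1_mulV : left_inverse pi1_one pi1_inv pi1_mul.
Proof. by move=> a; apply: pi1_eq; exact: reduce_winvl. Qed.

Lemma pi1_mulrV : right_inverse pi1_one pi1_inv pi1_mul.
Proof. by move=> a; apply: pi1_eq; exact: reduce_winvr. Qed.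

HB.instance Definition _ := gen_eqMixin (pi1 v).
HB.instance Definition _ := gen_choiceMixin (pi1 v).
HB.instance Definition _ :=
  isGroup.Build (pi1 v) pi1_mulA pi1_mul1 pi1_mulr1 pi1_mulV pi1_mulrV.

End FundamentalGroup.

Section Induced.
Variables (F E : digraph) (p : covering F E).

Definition lmap (x : letter F) : letter E :=
  match x with Fwd f => Fwd (hom1 p f) | Bwd f => Bwd (hom1 p f) end.

Lemma lsrc_lmap x : lsrc (lmap x) = hom0 p (lsrc x).
Proof. by case: x => f /=; rewrite ?hom_src ?hom_rng. Qed.

Lemma lrng_lmap x : lrng (lmap x) = hom0 p (lrng x).
Proof. by case: x => f /=; rewrite ?hom_src ?hom_rng. Qed.

Lemma lmap_inv x : lmap (linv x) = linv (lmap x).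
Proof. by case: x. Qed.

Lemma lmap_walk u a : walk_from u a -> walk_from (hom0 p u) (map lmap a).
Proof. by elim: a u => //= x a IH u [<- /IH]; rewrite lsrc_lmap lrng_lmap. Qed.

Lemma lmap_end u a : walk_end (hom0 p u) (map lmap a) = hom0 p (walk_end u a).
Proof.
elim: a u => //= x a IH u.
rewrite -[LHS]/(walk_end (lrng (lmap x)) (map lmap a)) lrng_lmap IH.
by [].
Qed.

Lemma lmap_inj x y : lsrc x = lsrc y -> lmap x = lmap y -> x = y.
Proof.
case: x y => [e|e] [f|f] //= ef [pef]; congr (_ _).
  by have [_ + _] := cov_src p (src f); apply=> //; rewrite inE.
by have [_ + _] := cov_rng p (rng f); apply=> //; rewrite inE.
Qed.

Lemma lmap_cancel u x a : walk_from u (x :: a) ->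
  cancel_cons (lmap x) (map lmap a) = map lmap (cancel_cons x a).
Proof.
case: a => [|y a] //= [_ [yx _]].
case: asboolP => [e|e]; case: asboolP => [e'|e'] //=.
- by case: e'; apply: lmap_inj; rewrite ?lsrc_inv ?lmap_inv.
- by case: e; rewrite e' lmap_inv.
Qed.

Lemma lmap_reduce u a : walk_from u a -> reduce (map lmap a) = map lmap (reduce a).
Proof.
elim: a u => //= x a IH u [xu wa]; rewrite (IH _ wa) (@lmap_cancel u) //=.
by split=> //; exact: (proj1 (reduce_walk wa)).
Qed.

Lemma lmap_reduced u a : walk_from u a -> reduced a -> reduced (map lmap a).
Proof.
move=> wa ra; rewrite -(reduce_id ra) -(lmap_reduce wa); exact: reduce_reduced.
Qed.

Definition pstar (a : rwalk F) : rwalk E :=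
  @RWalk E (hom0 p (wsrc a)) (map lmap (word a)) (lmap_walk (word_walk a))
    (lmap_reduced (word_walk a) (@word_reduced F a)).

Lemma wrng_pstar a : wrng (pstar a) = hom0 p (wrng a).
Proof. exact: lmap_end. Qed.

Variables (w : vert F) (v : vert E) (pw : hom0 p w = v).

Definition pi1_map (a : pi1 w) : pi1 v :=
  @Pi1 E v (pstar a) (etrans (congr1 (hom0 p) (pi1_src a)) pw)
    (etrans (wrng_pstar a) (etrans (congr1 (hom0 p) (pi1_rng a)) pw)).

Local Open Scope group_scope.

Lemma pi1_map1 : pi1_map 1 = 1.
Proof. exact: pi1_eq. Qed.

Lemma pi1_mapM a b : pi1_map (a * b) = pi1_map a * pi1_map b.
Proof.
apply: pi1_eq => /=; rewrite -map_cat (@lmap_reduce w) //; apply/walk_from_cat.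
case: a b => [a sa ta] [b sb tb] /=; split; first by rewrite -sa; exact: word_walk.
by rewrite -{1}sa -/(wrng a) ta -sb; exact: word_walk.
Qed.

Lemma pi1_mapV a : pi1_map a^-1 = (pi1_map a)^-1.
Proof.
by apply: pi1_eq; rewrite /= /winv map_rev -!map_comp (eq_map lmap_inv).
Qed.

Definition pi1_image : {pred pi1 v} := [pred g | `[< exists a, g = pi1_map a >]].

Lemma pi1_imageM : mulg_closed pi1_image.
Proof.
move=> g h /asboolP[a ->] /asboolP[b ->].
by apply/asboolP; exists (a * b); rewrite pi1_mapM.
Qed.

Lemma pi1_image1 : 1 \in pi1_image.
Proof. by apply/asboolP; exists 1; rewrite pi1_map1. Qed.

Lemma pi1_imageV : invg_closed pi1_image.
Proof. by move=> g /asboolP[a ->]; apply/asboolP; exists a^-1; rewrite pi1_mapV. Qed.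

HB.instance Definition _ := isMulClosed.Build (pi1 v) pi1_image pi1_imageM.
HB.instance Definition _ := isMul1Closed.Build (pi1 v) pi1_image pi1_image1.
HB.instance Definition _ := isInvClosed.Build (pi1 v) pi1_image pi1_imageV.

End Induced.

Definition connected (E : digraph) : Prop :=
  forall u v : vert E, u <> v -> exists a : rwalk E, wsrc a = u /\ wrng a = v.

Definition is_tree (E : digraph) : Prop :=
  forall u v : vert E, exists! a : rwalk E, wsrc a = u /\ wrng a = v.

Record subgraph (E : digraph) : Type := Subgraph {
  sub_vert : set (vert E);
  sub_edge : set (edge E);
  sub_rng : forall e, sub_edge e -> sub_vert (rng e);
  sub_src : forall e, sub_edge e -> sub_vert (src e) }.

Definition graph_of_sub (E : digraph) (T : subgraph E) : digraph :=
  @Digraph {u : vert E | sub_vert T u} {e : edge E | sub_edge T e}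
    (fun e => exist _ (rng (sval e)) (sub_rng (svalP e)))
    (fun e => exist _ (src (sval e)) (sub_src (svalP e))).

Definition spanning_tree (E : digraph) (T : subgraph E) : Prop :=
  is_tree (graph_of_sub T) /\ sub_vert T = setT.

Section SkewProduct.
Variables (G : groupType) (H : groupClosed G).
Local Open Scope group_scope.

Definition rcoset (g : G) : set G := [set h * g | h in [set` H]].

Definition rcosets : Type := {A : set G | exists g, A = rcoset g}.

Lemma rcoset_mulP (A : set G) (x : G) :
  (exists g, A = rcoset g) -> exists g, [set a * x | a in A] = rcoset g.
Proof.
move=> [g ->]; exists (g * x); rewrite /rcoset image_comp.
by apply: eq_imagel => h _ /=; rewrite mulgA.
Qed.

(* (Hg)x = H(gx), so Hg |-> Hgx does not depend on the representative g. *)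
Definition rcoset_mul (A : rcosets) (x : G) : rcosets :=
  exist _ [set a * x | a in sval A] (rcoset_mulP x (svalP A)).

Definition skew_product (E : digraph) (c : edge E -> G) : digraph :=
  @Digraph (vert E * rcosets) (edge E * rcosets)
    (fun eA => (rng eA.1, rcoset_mul eA.2 (c eA.1)))
    (fun eA => (src eA.1, eA.2)).

End SkewProduct.

(* Main.v *)
Require Import Defs.
From mathcomp Require Import all_boot.
From mathcomp Require Import boolp classical_sets functions.

(** For each vertex [x] of [E] fix a walk [t x] from [v] to [x]; the walks
    inside a spanning tree are one such choice, but no coherence between the
    [t x] is needed, so connectedness of [E] suffices. Let
    [c e = t (src e) * e * (t (rng e))^-1], which is a closed walk at [v]. For
    a covering [p : F -> E] with [p w = v] and [H] the image of [pi_1(F, w)],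
    attach to a vertex [u] of [F] the set [fibre_coset u] of all [g] in
    [pi_1(E, v)] such that [g * t (p u)] is homotopic to the projection of a
    walk from [w] to [u]. This set is a right coset of [H]
    ([fibre_coset_rcoset]): two walks from [w] to [u] differ by a closed walk
    at [w]. The isomorphism sends [u] to [(p u, fibre_coset u)] and an edge [f]
    to [(p f, fibre_coset (src f))].

    It respects ranges because [g * c e * t (rng e)] is homotopic to
    [g * t (src e) * e]: a walk to [src f] followed by [f] is a walk to [rng f]
    ([fibre_coset_step]). It is injective on vertices by uniqueness of lifts,
    which makes the endpoint of a walk from [w] depend only on the homotopy
    class of its projection ([lift_end_homotopic]), and surjective because
    [g * t x] lifts to a walk starting at [w] ([lift_walk]). Bijectivity on
    edges follows from that on vertices, as [p] is bijective on the edges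
    leaving a given vertex. *)

Set Implicit Arguments.
Unset Strict Implicit.
Unset Printing Implicit Defensive.

Local Open Scope classical_set_scope.

(** * Homotopy of words and closed walks *)

Section Homotopy.
Variable E : digraph.
Implicit Types a b : seq (letter E).

(** Homotopy of words: equality after cancellation. *)
Definition homotopic a b : Prop := reduce a = reduce b.

Lemma homotopic_cat a a' b b' :
  homotopic a a' -> homotopic b b' -> homotopic (a ++ b) (a' ++ b').
Proof.
move=> aa bb; rewrite /homotopic -reduce_catl -reduce_catr aa bb.
by rewrite reduce_catl reduce_catr.
Qed.

Lemma homotopic_reduce a : homotopic (reduce a) a.
Proof. by rewrite /homotopic reduce_id //; exact: reduce_reduced. Qed.

Lemma homotopic_winvl a b : homotopic (winv a ++ a ++ b) b.
Proof. by rewrite /homotopic catA -reduce_catl reduce_winvl. Qed.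

Lemma homotopic_winvr a b : homotopic (a ++ winv a ++ b) b.
Proof. by rewrite /homotopic catA -reduce_catl reduce_winvr. Qed.

Lemma homotopic_winv a b : homotopic a b -> homotopic (winv a) (winv b).
Proof.
move=> ab; rewrite /homotopic -(homotopic_winvl b (winv a)).
transitivity (reduce (winv b ++ a ++ winv a)).
  by apply: homotopic_cat => //; exact: homotopic_cat.
by rewrite -reduce_catr reduce_winvr cats0.
Qed.

Variable v : vert E.

(** The element of the fundamental group represented by a closed walk. *)
Definition pi1_of_walk a (wa : walk_from v a) (ea : walk_end v a = v) : pi1 v :=
  @Pi1 E v (@RWalk E v (reduce a) (proj1 (reduce_walk wa)) (@reduce_reduced E a))
    erefl (etrans (proj2 (reduce_walk wa)) ea).

Lemma pi1_walk_from (g : pi1 v) : walk_from v (word g).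
Proof. by case: g => a sa ta /=; rewrite -{1}sa; exact: word_walk. Qed.

Lemma pi1_walk_end (g : pi1 v) : walk_end v (word g) = v.
Proof. by case: g => a sa ta /=; rewrite -{1}sa. Qed.

Lemma pi1_homotopic (g h : pi1 v) : homotopic (word g) (word h) -> g = h.
Proof.
move=> gh; apply: pi1_eq.
by rewrite -(reduce_id (@word_reduced E g)) gh reduce_id //; exact: word_reduced.
Qed.

End Homotopy.

(** * Lifting walks through a covering *)

Section Lifting.
Variables (F E : digraph) (p : covering F E).

Lemma lift_edge (u : vert F) (e : edge E) :
  src e = hom0 p u -> exists2 f, src f = u & hom1 p f = e.
Proof. by move=> eu; have [_ _ /(_ e eu) [f fu <-]] := cov_src p u; exists f. Qed.

Lemma lift_letter (u : vert F) (x : letter E) :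
  lsrc x = hom0 p u -> exists2 y, lsrc y = u & lmap p y = x.
Proof.
case: x => e /= eu.
  by have [f fu <-] := lift_edge eu; exists (Fwd f).
by have [_ _ /(_ e eu) [f fu <-]] := cov_rng p u; exists (Bwd f).
Qed.

(** Path lifting. *)
Lemma lift_walk (u : vert F) a : walk_from (hom0 p u) a ->
  exists2 b, walk_from u b & map (lmap p) b = a.
Proof.
elim: a u => [|x a IH] u /=; first by exists [::].
move=> [/lift_letter [y yu <-]]; rewrite lrng_lmap => /IH [b wb <-].
by exists (y :: b).
Qed.

(** Uniqueness of lifts. *)
Lemma lift_uniq (u : vert F) b b' : walk_from u b -> walk_from u b' ->
  map (lmap p) b = map (lmap p) b' -> b = b'.
Proof.
elim: b b' u => [|x b IH] [|x' b'] u //= [xu wb] [xu' wb'] [xx' bb'].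
have ? : x = x' by apply: lmap_inj xx'; rewrite xu.
by subst x'; rewrite (IH _ _ wb wb' bb').
Qed.

Lemma lift_end_homotopic (u : vert F) b b' : walk_from u b -> walk_from u b' ->
  homotopic (map (lmap p) b) (map (lmap p) b') -> walk_end u b = walk_end u b'.
Proof.
move=> wb wb'; rewrite /homotopic (lmap_reduce _ wb) (lmap_reduce _ wb') => bb'.
have [rb <-] := reduce_walk wb; have [rb' <-] := reduce_walk wb'.
by rewrite (lift_uniq rb rb' bb').
Qed.

Lemma lmap_winv (b : seq (letter F)) :
  map (lmap p) (winv b) = winv (map (lmap p) b).
Proof. by rewrite /winv map_rev -!map_comp (eq_map (lmap_inv p)). Qed.

End Lifting.

(** * The skew product attached to a covering *)

Section Classification.
Variables (E : digraph) (v : vert E) (t : vert E -> seq (letter E)).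
Hypothesis t_walk : forall x, walk_from v (t x).
Hypothesis t_end : forall x, walk_end v (t x) = x.

Let cocycle_word e := t (src e) ++ Fwd e :: winv (t (rng e)).

Lemma cocycle_walk e :
  walk_from v (cocycle_word e) /\ walk_end v (cocycle_word e) = v.
Proof.
have [] := winv_walk (t_walk (rng e)); rewrite t_end => wt et.
by rewrite walk_from_cat walk_end_cat t_end.
Qed.

(** The cocycle [e |-> t (src e) * e * (t (rng e))^-1]. *)
Definition cocycle (e : edge E) : pi1 v :=
  pi1_of_walk (proj1 (cocycle_walk e)) (proj2 (cocycle_walk e)).

Lemma cocycle_homotopic e :
  homotopic (word (cocycle e) ++ t (rng e)) (t (src e) ++ [:: Fwd e]).
Proof.
rewrite /= /homotopic reduce_catl /cocycle_word -catA; apply: homotopic_cat => //.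
exact: (congr1 (cancel_cons (Fwd e)) (reduce_winvl _)).
Qed.

Variables (F : digraph) (p : covering F E) (w : vert F) (pw : hom0 p w = v).
Hypothesis connF : connected F.

Let H := pi1_image pw.

Lemma connected_walk (u : vert F) : exists2 b, walk_from w b & walk_end w b = u.
Proof.
have [->|/connF [a [sa <-]]] := pselect (w = u); first by exists [::].
by exists (word a); rewrite -sa //; exact: word_walk.
Qed.

(** The elements [g] such that [g * t (p u)] is the projection, up to
    homotopy, of a walk from [w] to [u]. *)
Definition fibre_coset (u : vert F) : set (pi1 v) :=
  [set g | exists b, [/\ walk_from w b, walk_end w b = u &
     homotopic (map (lmap p) b) (word g ++ t (hom0 p u))]].

Lemma fibre_coset_neq0 u : fibre_coset u !=set0.
Proof.
have [b wb bu] := connected_walk u.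
have [] := winv_walk (t_walk (hom0 p u)); rewrite t_end => wt et.
have wa : walk_from v (map (lmap p) b ++ winv (t (hom0 p u))).
  rewrite walk_from_cat -pw lmap_end bu.
  by split; first exact: lmap_walk.
have ea : walk_end v (map (lmap p) b ++ winv (t (hom0 p u))) = v.
  by rewrite walk_end_cat -{1}pw lmap_end bu.
exists (pi1_of_walk wa ea), b; split => //=.
rewrite /homotopic reduce_catl -catA -reduce_catr reduce_winvl.
by rewrite cats0.
Qed.

Lemma fibre_coset_sub u g : fibre_coset u g -> rcoset H g `<=` fibre_coset u.
Proof.
move=> [b [wb bu bg]] _ [_ /asboolP[a ->] <-].
exists (word a ++ b); split.
- by rewrite walk_from_cat pi1_walk_end; split; first exact: pi1_walk_from.
- by rewrite walk_end_cat pi1_walk_end.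
- rewrite map_cat /= /homotopic reduce_catl -catA.
  exact: homotopic_cat.
Qed.

Lemma fibre_coset_rcoset u g : fibre_coset u g -> fibre_coset u = rcoset H g.
Proof.
move=> gu; apply/seteqP; split; last exact: fibre_coset_sub.
move: gu => [b [wb bu bg]] h [b' [wb' bu' bh]].
have [] := winv_walk wb; rewrite bu => wib eib.
(* b' followed by the reverse of b is a closed walk at w whose projection
   represents h * g^-1. *)
have wa : walk_from w (b' ++ winv b) by rewrite walk_from_cat bu'.
have ea : walk_end w (b' ++ winv b) = w by rewrite walk_end_cat bu'.
pose a := pi1_of_walk wa ea.
exists (pi1_map pw a); first by apply/asboolP; exists a.
apply: pi1_homotopic; rewrite /= /homotopic.
rewrite (homotopic_reduce _) -(lmap_reduce p wa) reduce_catl.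
rewrite map_cat lmap_winv -catA.
have bgV := homotopic_winv bg.
transitivity (reduce ((word h ++ t (hom0 p u)) ++
    winv (word g ++ t (hom0 p u)) ++ word g)).
  by do 2!apply: homotopic_cat => //.
rewrite winv_cat -!catA.
apply: etrans; last by rewrite -[word h]cats0; reflexivity.
apply: homotopic_cat => //.
by rewrite /homotopic (homotopic_winvr _) reduce_winvl.
Qed.

Lemma fibre_coset_step f g : fibre_coset (src f) g ->
  fibre_coset (rng f) (g * cocycle (hom1 p f))%g.
Proof.
move=> [b [wb bf bg]]; exists (b ++ [:: Fwd f]); split.
- by rewrite walk_from_cat bf.
- by rewrite walk_end_cat.
rewrite map_cat /= -hom_rng; rewrite -hom_src in bg.
rewrite /homotopic reduce_catl -catA.
transitivity (reduce (word g ++ t (src (hom1 p f)) ++ [:: Fwd (hom1 p f)])).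
  by rewrite catA; exact: homotopic_cat.
apply: homotopic_cat => //; apply: esym; exact: cocycle_homotopic.
Qed.

Lemma fibre_coset_inj u u' :
  hom0 p u = hom0 p u' -> fibre_coset u = fibre_coset u' -> u = u'.
Proof.
move=> uu' KK; have [g gu] := fibre_coset_neq0 u.
move: (gu); rewrite KK => -[b' [wb' bu' bg']].
case: gu => b [wb bu bg]; rewrite -bu -bu'.
apply: (lift_end_homotopic (p := p) wb wb').
by rewrite /homotopic bg bg' uu'.
Qed.

Lemma fibre_coset_surj x g :
  exists2 u, hom0 p u = x & fibre_coset u = rcoset H g.
Proof.
have wa : walk_from (hom0 p w) (word g ++ t x).
  rewrite pw walk_from_cat pi1_walk_end; split; last exact: t_walk.
  exact: pi1_walk_from.
have [b wb pb] := lift_walk wa; exists (walk_end w b).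
  by rewrite -lmap_end pb pw walk_end_cat pi1_walk_end t_end.
apply: fibre_coset_rcoset; exists b; split => //.
by rewrite -lmap_end pb {1}pw walk_end_cat pi1_walk_end t_end.
Qed.

(** [fibre_coset u] as an element of [H\pi_1(E, v)]. *)
Definition fibre_rcoset (u : vert F) : rcosets H :=
  exist _ (fibre_coset u)
    (let: ex_intro g gu := fibre_coset_neq0 u in
     ex_intro _ g (fibre_coset_rcoset gu)).

Lemma rcosets_eq (A B : rcosets H) : sval A = sval B -> A = B.
Proof.
case: A B => [A hA] [B hB] /= AB; subst B.
by congr exist; exact: Prop_irrelevance.
Qed.

Lemma fibre_rcoset_rng f :
  fibre_rcoset (rng f) = rcoset_mul (fibre_rcoset (src f)) (cocycle (hom1 p f)).
Proof.
apply: rcosets_eq => /=; have [g gf] := fibre_coset_neq0 (src f).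
rewrite (fibre_coset_rcoset (fibre_coset_step gf)) (fibre_coset_rcoset gf).
rewrite /rcoset image_comp; apply: eq_imagel => h _ /=.
by rewrite mulgA.
Qed.

Lemma fibre_rcoset_surj x (A : rcosets H) :
  exists2 u, hom0 p u = x & fibre_rcoset u = A.
Proof.
case: A => A [g Ag]; have [u ux Ku] := fibre_coset_surj x g.
by exists u => //; apply: rcosets_eq; rewrite /= Ku Ag.
Qed.

(** The graph morphism [u |-> (p u, fibre_coset u)],
    [f |-> (p f, fibre_coset (src f))]. *)
Definition covering_skew_hom : graph_hom F (skew_product H cocycle) :=
  @GraphHom F (skew_product H cocycle)
    (fun u => (hom0 p u, fibre_rcoset u))
    (fun f => (hom1 p f, fibre_rcoset (src f)))
    (fun f => congr2 pair (hom_rng p f) (esym (fibre_rcoset_rng f)))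
    (fun f => congr2 pair (hom_src p f) erefl).

Lemma covering_skew_iso : graph_iso F (skew_product H cocycle).
Proof.
exists covering_skew_hom; split; rewrite -setTT_bijective; split => //=.
- by move=> u u' _ _ [uu' KK]; exact: fibre_coset_inj.
- by move=> [x A] _; have [u <- <-] := fibre_rcoset_surj x A; exists u.
- move=> f f' _ _ [ff' KK].
  have sf : src f = src f'.
    by apply: fibre_coset_inj => //; rewrite -!hom_src ff'.
  by have [_ + _] := cov_src p (src f); apply=> //; rewrite inE.
- move=> [e A] _; have [u ue <-] := fibre_rcoset_surj (src e) A.
  by have [f <- <-] := lift_edge (esym ue); exists f.
Qed.

End Classification.

Theorem theorem5p2 (E : digraph) (T : subgraph E) (v : vert E)
    (connE : connected E) (spanT : spanning_tree T) :
  exists c : edge E -> pi1 v,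
    forall (F : digraph) (p : covering F E) (w : vert F) (pw : hom0 p w = v),
      connected F ->
      graph_iso F (skew_product (pi1_image pw) c).
Proof.
have /choice[t tP] (x : vert E) : exists a, walk_from v a /\ walk_end v a = x.
  by have [a] := connected_walk v connE x; exists a.
exists (cocycle (fun x => proj1 (tP x)) (fun x => proj2 (tP x))).
move=> F p w pw connF; exact: covering_skew_iso.
Qed.
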